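(* Let $G$ be a Hurwitz $C$-group consisting of $n$ irreducible components and let $\Delta(t)$ be its Alexander polynomial. Then $$\Delta(t)=(t-1)^{n-1}P(t),$$ where the polynomial $P(t)\in\mathbb Z[t]$ satisfies $P(1)\neq0$.
   Context: $C$-groups. A $C$-group is a group $G$ together with a finite presentation $\langle x_1,\dots,x_m\mid x_i=w_{i,j,k}^{-1}x_jw_{i,j,k}\rangle$ (a $C$-presentation), where the $w_{i,j,k}$ ($1\le i,j\le m$, $1\le k\le h(i,j)$, $h:\{1,\dots,m\}^2\to\mathbb Z$ some function) are certain elements of the free group on $x_1,\dots,x_m$ (all relations are conjugations of generators). The images of the $x_i$ in $G$ and all their conjugates are the $C$-generators of $G$. A $C$-presentation is a Hurwitz $C$-presentation of degree $m$ if for each $i=1,\dots,m$ the word $w_{i,i,1}$ is the product $x_1\cdots x_m$; a $C$-group is a Hurwitz $C$-group (of degree $m$) if it possesses a Hurwitz $C$-presentation of degree $m$, in other words, if it is generated by $C$-generators $x_1,\dots,x_m$ such that $x_1\cdots x_m$ belongs to the centre of $G$. For a $C$-group $G$ the abelianization $G/G'$ is a finitely generated free abelian group; $G$ consists of $n$ irreducible components if $G/G'\simeq\mathbb Z^n$. Alexander polynomial. $\mathbb F_1$ is the infinite cyclic group with its fixed generator; $\nu:G\to\mathbb F_1$ is the epimorphism sending every $C$-generator to the generator of $\mathbb F_1$; $N=\ker\nu$, $N'$ is its commutator subgroup. The generator of $\mathbb F_1$ acts on $N/N'$ by $h:b\mapsto\tilde x^{-1}b\tilde x$, where $\tilde x$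 is any $C$-generator; $h_{\mathbb C}$ is the induced automorphism of $(N/N')\otimes\mathbb C$. The Alexander polynomial of $G$ is $\Delta(t)=\det(h_{\mathbb C}-t\,\mathrm{Id})$ (and $\Delta\equiv0$ if $(N/N')\otimes\mathbb C$ is infinite dimensional). *)

(* Defs.v *)
From HB Require Import structures.
From mathcomp Require Import all_boot all_algebra.
From mathcomp Require Import boolp classical_sets reals complex.

Set Implicit Arguments.
Unset Strict Implicit.
Unset Printing Implicit Defensive.

Import GRing.Theory.

Local Open Scope quotient_scope.
Local Open Scope classical_set_scope.
Local Open Scope ring_scope.

Section Abelianization.
Variable K : groupType.

Inductive generated (S : set K) : set K :=
| gen_in x of S x : generated S x
| gen_one : generated S 1%g
| gen_mul x y of generated S x & generated S y : generated S (x * y)%g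
| gen_inv x of generated S x : generated S x^-1%g.

Definition commutator_subgroup : set K :=
  generated [set g | exists a b : K, g = [~ a, b]%g].

Local Notation K' := commutator_subgroup.

Lemma commutator_conj g x : K' g -> K' (g ^ x)%g.
Proof.
move=> Kg; rewrite -[(g ^ x)%g](mulVKg g) -/(commg g x).
by apply: gen_mul => //; apply: gen_in; exists g, x.
Qed.

Definition ab_rel (x y : K) : bool := `[< K' (x^-1 * y)%g >].

Lemma ab_rel_equiv : equiv_class_of ab_rel.
Proof.
split=> [x|x y|y x z]; first by apply/asboolP; rewrite mulVg; exact: gen_one.
  by apply/asboolP/asboolP => /gen_inv; rewrite invgM invgK.
move=> /asboolP xy /asboolP yz; apply/asboolP.
by rewrite -(mulVKg y z) mulgA; apply: gen_mul => //; rewrite mulgA in yz *.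
Qed.

Canonical ab_equiv := EquivRelPack ab_rel_equiv.
Canonical ab_encModRel := defaultEncModRel ab_rel.

Definition abelianization := {eq_quot ab_rel}.
HB.instance Definition _ : EqQuotient K ab_rel abelianization :=
  EqQuotient.on abelianization.
HB.instance Definition _ := Choice.on abelianization.

Definition ab (x : K) : abelianization := \pi x.

Lemma ab_eqP x y : reflect (K' (x^-1 * y)%g) (ab x == ab y).
Proof. by rewrite /ab eqmodE; apply: asboolP. Qed.

Lemma ab_repr (u : abelianization) : ab (repr u) = u.
Proof. exact: reprK. Qed.

Definition ab_add (u v : abelianization) := ab (repr u * repr v)%g.
Definition ab_opp (u : abelianization) := ab (repr u)^-1%g.

Lemma ab_addE x y : ab_add (ab x) (ab y) = ab (x * y)%g.
Proof.
have /eqP/ab_eqP rx : ab (repr (ab x)) = ab x by rewrite ab_repr.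
have /eqP/ab_eqP ry : ab (repr (ab y)) = ab y by rewrite ab_repr.
apply/eqP/ab_eqP; rewrite invgM.
have -> : ((repr (ab y))^-1 * (repr (ab x))^-1 * (x * y) =
   ((repr (ab x))^-1 * x) ^ repr (ab y) * ((repr (ab y))^-1 * y))%g.
  by rewrite /conjg !mulgA mulgK.
by apply: gen_mul => //; apply: commutator_conj.
Qed.

Lemma ab_oppE x : ab_opp (ab x) = ab x^-1%g.
Proof.
have /eqP/ab_eqP rx : ab x = ab (repr (ab x)) by rewrite ab_repr.
apply/eqP/ab_eqP; rewrite invgK.
have -> : (repr (ab x) * x^-1 = (x^-1 * repr (ab x)) ^ x^-1)%g.
  by rewrite /conjg invgK !mulgA mulgV mul1g.
exact: commutator_conj.
Qed.

Lemma ab_addA : associative ab_add.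
Proof.
move=> u v w; rewrite -(ab_repr u) -(ab_repr v) -(ab_repr w).
by rewrite !ab_addE mulgA.
Qed.

Lemma ab_addC : commutative ab_add.
Proof.
move=> u v; rewrite -(ab_repr u) -(ab_repr v) !ab_addE.
apply/eqP/ab_eqP; apply: gen_in; exists (repr v), (repr u).
by rewrite invgM /commg /conjg !mulgA.
Qed.

Lemma ab_add0 : left_id (ab 1%g) ab_add.
Proof. by move=> u; rewrite -(ab_repr u) ab_addE mul1g. Qed.

Lemma ab_addN : left_inverse (ab 1%g) ab_opp ab_add.
Proof. by move=> u; rewrite -(ab_repr u) ab_oppE ab_addE mulVg. Qed.

HB.instance Definition _ :=
  GRing.isZmodule.Build abelianization ab_addA ab_addC ab_add0 ab_addN.

Lemma abM : {morph ab : x y / (x * y)%g >-> x + y}.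
Proof. by move=> x y; rewrite -ab_addE. Qed.

End Abelianization.

Section AbelianizationMap.
Variables (K L : groupType) (f : UMagmaMorphism.type K L).

Definition ab_map (u : abelianization K) : abelianization L := ab (f (repr u)).

Lemma ab_mapE x : ab_map (ab x) = ab (f x).
Proof.
have /eqP/ab_eqP : ab (repr (ab x)) = ab x by rewrite ab_repr.
rewrite /ab_map; move: (repr _) => y yx; apply/eqP/ab_eqP.
have -> : ((f y)^-1 * f x = f (y^-1 * x))%g by rewrite gmulfM gmulfV.
elim: yx => {y} [z [a [b ->]]||y z _ IHy _ IHz|y _ IH].
- by apply: gen_in; exists (f a), (f b); rewrite gmulfR.
- by rewrite gmulf1; apply: gen_one.
- by rewrite gmulfM; apply: gen_mul.
- by rewrite gmulfV; apply: gen_inv.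
Qed.

Lemma ab_map_is_additive : zmod_morphism ab_map.
Proof.
have D u v : ab_map (u + v) = ab_map u + ab_map v.
  by rewrite -(ab_repr u) -(ab_repr v) -abM !ab_mapE gmulfM abM.
by move=> u v; apply/eqP; rewrite eq_sym subr_eq -D subrK.
Qed.

HB.instance Definition _ :=
  GRing.isZmodMorphism.Build (abelianization K) (abelianization L) ab_map
    ab_map_is_additive.

End AbelianizationMap.

Section Tensor.
Variables (A : zmodType) (F : comNzRingType).

(* The list [:: (a_1, c_1); ...; (a_r, c_r)] stands for the formal sum of     *)
(* the a_i (x) c_i; tensor_eq is the least congruence for concatenation that *)
(* makes it commutative and (x) biadditive.                                  *)
Inductive tensor_eq : seq (A * F) -> seq (A * F) -> Prop :=
| teq_refl s : tensor_eq s s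
| teq_sym s t of tensor_eq s t : tensor_eq t s
| teq_trans s t r of tensor_eq s t & tensor_eq t r : tensor_eq s r
| teq_cat s s' t t' of tensor_eq s s' & tensor_eq t t' :
    tensor_eq (s ++ t) (s' ++ t')
| teq_comm s t : tensor_eq (s ++ t) (t ++ s)
| teq_addl a b c : tensor_eq [:: (a + b, c)] [:: (a, c); (b, c)]
| teq_addr a c d : tensor_eq [:: (a, c + d)] [:: (a, c); (a, d)]
| teq_zero a : tensor_eq [:: (a, 0)] [::].

Definition tensor_rel s t : bool := `[< tensor_eq s t >].

Lemma tensor_rel_equiv : equiv_class_of tensor_rel.
Proof.
split=> [s|s t|t s r]; first by apply/asboolP; exact: teq_refl.
  by apply/asboolP/asboolP; exact: teq_sym.
by move=> /asboolP st /asboolP tr; apply/asboolP; exact: teq_trans tr.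
Qed.

Canonical tensor_equiv := EquivRelPack tensor_rel_equiv.
Canonical tensor_encModRel := defaultEncModRel tensor_rel.

Definition tensor := {eq_quot tensor_rel}.
HB.instance Definition _ : EqQuotient (seq (A * F)) tensor_rel tensor :=
  EqQuotient.on tensor.
HB.instance Definition _ := Choice.on tensor.

Definition tsum (s : seq (A * F)) : tensor := \pi s.

Lemma tsumP s t : tsum s = tsum t <-> tensor_eq s t.
Proof.
rewrite /tsum; split=> [/eqmodP/asboolP //|st].
by apply/eqmodP/asboolP.
Qed.

Lemma tsum_repr u : tsum (repr u) = u.
Proof. exact: reprK. Qed.

Let scale_seq (c : F) (s : seq (A * F)) := [seq (ad.1, c * ad.2) | ad <- s].

Definition tensor_add (u v : tensor) := tsum (repr u ++ repr v).
Definition tensor_scale (c : F) (u : tensor) := tsum (scale_seq c (repr u)).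

Lemma tensor_addE s t : tensor_add (tsum s) (tsum t) = tsum (s ++ t).
Proof. by apply/tsumP/teq_cat; apply/tsumP; rewrite tsum_repr. Qed.

Lemma tensor_scaleE c s : tensor_scale c (tsum s) = tsum (scale_seq c s).
Proof.
have /tsumP : tsum (repr (tsum s)) = tsum s by rewrite tsum_repr.
rewrite /tensor_scale; move: (repr _) => r rs; apply/tsumP.
elim: rs => {r s} [s|s t _ /teq_sym //|s t r _ + _|s s' t t' _ + _|s t|a b d|a d e|a].
- exact: teq_refl.
- exact: teq_trans.
- by rewrite /scale_seq !map_cat; apply: teq_cat.
- by rewrite /scale_seq !map_cat; apply: teq_comm.
- exact: teq_addl.
- by rewrite /= mulrDr; apply: teq_addr.
- by rewrite /= mulr0; apply: teq_zero.
Qed.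

Lemma tensor_addA : associative tensor_add.
Proof.
move=> u v w; rewrite -(tsum_repr u) -(tsum_repr v) -(tsum_repr w).
by rewrite !tensor_addE catA.
Qed.

Lemma tensor_addC : commutative tensor_add.
Proof.
move=> u v; rewrite -(tsum_repr u) -(tsum_repr v) !tensor_addE.
exact/tsumP/teq_comm.
Qed.

Lemma tensor_add0 : left_id (tsum [::]) tensor_add.
Proof. by move=> u; rewrite -(tsum_repr u) tensor_addE. Qed.

Lemma tensor_scaleDl u c d :
  tensor_scale (c + d) u = tensor_add (tensor_scale c u) (tensor_scale d u).
Proof.
rewrite -(tsum_repr u) !tensor_scaleE tensor_addE; apply/tsumP.
elim: (repr u) => [|[a e] s IH] /=; first exact: teq_refl.
rewrite mulrDl; apply: teq_trans (teq_cat (teq_addr _ _ _) IH) _.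
apply: (teq_cat (teq_refl [:: (a, c * e)])).
rewrite -[in X in tensor_eq _ X]cat1s catA.
exact: (teq_cat (teq_comm [:: (a, d * e)] _) (teq_refl _)).
Qed.

Lemma tensor_scale0 u : tensor_scale 0 u = tsum [::].
Proof.
rewrite -(tsum_repr u) tensor_scaleE; apply/tsumP.
elim: (repr u) => [|[a e] s IH] /=; first exact: teq_refl.
by rewrite mul0r -cat1s; apply: (teq_cat (teq_zero a) IH).
Qed.

Lemma tensor_scaleDr c u v : tensor_scale c (tensor_add u v) =
  tensor_add (tensor_scale c u) (tensor_scale c v).
Proof.
rewrite -(tsum_repr u) -(tsum_repr v) !(tensor_scaleE, tensor_addE).
by rewrite /scale_seq map_cat.
Qed.

Lemma tensor_scaleA c d u :
  tensor_scale c (tensor_scale d u) = tensor_scale (c * d) u.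
Proof.
rewrite -(tsum_repr u) !tensor_scaleE /scale_seq -map_comp.
by congr tsum; apply: eq_map => ae /=; rewrite mulrA.
Qed.

Lemma tensor_scale1 : left_id 1 tensor_scale.
Proof.
move=> u; rewrite -[RHS]tsum_repr -{1}(tsum_repr u) tensor_scaleE.
by congr tsum; rewrite -[RHS]map_id; apply: eq_map => -[a e] /=; rewrite mul1r.
Qed.

Lemma tensor_addN :
  left_inverse (tsum [::]) (tensor_scale (-1)) tensor_add.
Proof.
by move=> u; rewrite -{2}(tensor_scale1 u) -tensor_scaleDl addNr tensor_scale0.
Qed.

HB.instance Definition _ :=
  GRing.isZmodule.Build tensor tensor_addA tensor_addC tensor_add0 tensor_addN.
HB.instance Definition _ := GRing.Zmodule_isLmodule.Build F tensor
  tensor_scaleA tensor_scale1 tensor_scaleDr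
  (fun u c d => tensor_scaleDl u c d).

Definition tens (a : A) (c : F) : tensor := tsum [:: (a, c)].

Lemma tsumE s : tsum s = \sum_(ac <- s) tens ac.1 ac.2.
Proof.
elim: s => [|[a c] s IH]; first by rewrite big_nil.
by rewrite big_cons -IH; symmetry; apply: tensor_addE.
Qed.

Lemma tensDl a b c : tens (a + b) c = tens a c + tens b c.
Proof. by rewrite [RHS]tensor_addE; apply/tsumP/teq_addl. Qed.

Lemma tensDr a c d : tens a (c + d) = tens a c + tens a d.
Proof. by rewrite [RHS]tensor_addE; apply/tsumP/teq_addr. Qed.

Lemma tensZ c a d : c *: tens a d = tens a (c * d).
Proof. exact: tensor_scaleE. Qed.

End Tensor.

Section TensorMap.
Variables (A B : zmodType) (F : comNzRingType) (f : {additive A -> B}).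

Definition tensor_map (u : tensor A F) : tensor B F :=
  tsum [seq (f ac.1, ac.2) | ac <- repr u].

Lemma tensor_map_tsum s :
  tensor_map (tsum s) = tsum [seq (f ac.1, ac.2) | ac <- s].
Proof.
have /tsumP : tsum (repr (tsum s)) = tsum s by rewrite tsum_repr.
rewrite /tensor_map; move: (repr _) => r rs; apply/tsumP.
elim: rs => {r s} [s|s t _ /teq_sym //|s t r _ + _|s s' t t' _ + _|s t|a b d|a d e|a].
- exact: teq_refl.
- exact: teq_trans.
- by rewrite !map_cat; apply: teq_cat.
- by rewrite !map_cat; apply: teq_comm.
- by rewrite /= raddfD; apply: teq_addl.
- exact: teq_addr.
- exact: teq_zero.
Qed.

Lemma tensor_mapE a c : tensor_map (tens a c) = tens (f a) c.
Proof. exact: tensor_map_tsum. Qed.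

Lemma tensor_map_is_linear : linear tensor_map.
Proof.
move=> c u v; rewrite -(tsum_repr u) -(tsum_repr v).
rewrite [_ *: _]tensor_scaleE [_ + _]tensor_addE !tensor_map_tsum.
rewrite [_ *: _]tensor_scaleE [RHS]tensor_addE map_cat -!map_comp.
by congr (tsum (_ ++ _)); apply: eq_map.
Qed.

HB.instance Definition _ :=
  GRing.isLinear.Build F (tensor A F) (tensor B F) _ tensor_map
    tensor_map_is_linear.

End TensorMap.

(* det (f - t Id), computed in the coordinates given by any linear           *)
(* isomorphism phi : V -> F^d, if V is finite dimensional; the default value *)
(* 0 of xget is taken exactly when no such phi exists. Since phi maps to row *)
(* vectors, the matrix M of f acts on the right.                             *)
Definition det_sub_t (F : fieldType) (V : lmodType F) (f : {linear V -> V}) :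
    {poly F} :=
  xget 0 [set D | exists (d : nat) (phi : {linear V -> 'rV[F]_d}) (M : 'M[F]_d),
    [/\ bijective phi, forall v, phi (f v) = phi v *m M &
        D = \det (map_mx polyC M - 'X%:M)]].

(* Elements of the free group on x_0, ..., x_{m-1} are given by (not          *)
(* necessarily reduced) words; the letter (i, false) is x_i and (i, true) is *)
(* its inverse.                                                              *)
Definition word (m : nat) := seq ('I_m * bool).

Definition letter m (i : 'I_m) : word m := [:: (i, false)].

Definition word_inv m (u : word m) : word m :=
  rev [seq (l.1, ~~ l.2) | l <- u].

Definition word_prod m : word m := [seq (i, false) | i <- enum 'I_m].

Definition word_eval (G : groupType) m (x : 'I_m -> G) (u : word m) : G :=
  (\prod_(l <- u) (if l.2 then (x l.1)^-1 else x l.1))%g.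

(* The relations are x_i = w_{i,j,k}^-1 x_j w_{i,j,k} for 1 <= k <= h(i,j);   *)
(* the values w i j k for other k are irrelevant.                            *)
Record C_presentation (m : nat) := CPresentation {
  C_h : 'I_m -> 'I_m -> nat;
  C_w : 'I_m -> 'I_m -> nat -> word m
}.

(* Equality of words in the presented group.                                 *)
Inductive C_eq m (p : C_presentation m) : word m -> word m -> Prop :=
| Ceq_refl u : C_eq p u u
| Ceq_sym u v of C_eq p u v : C_eq p v u
| Ceq_trans u v w of C_eq p u v & C_eq p v w : C_eq p u w
| Ceq_cat u u' v v' of C_eq p u u' & C_eq p v v' : C_eq p (u ++ v) (u' ++ v')
| Ceq_cancel i b : C_eq p [:: (i, b); (i, ~~ b)] [::]
| Ceq_rel i j k of (1 <= k <= C_h p i j)%N :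
    C_eq p (letter i) (word_inv (C_w p i j k) ++ letter j ++ C_w p i j k).

(* G is the group presented by p, with x_i the image of the i-th generator.  *)
Definition presents (G : groupType) m (p : C_presentation m) (x : 'I_m -> G) :=
  (forall g, exists u, word_eval x u = g) /\
  (forall u v, word_eval x u = word_eval x v <-> C_eq p u v).

Definition conjugates (G : groupType) m (x : 'I_m -> G) : set G :=
  [set g | exists i a, g = (x i ^ a)%g].

Record C_group := CGroup {
  C_sort :> groupType;
  C_rank : nat;
  C_rank_gt0 : (0 < C_rank)%N;
  C_pres : C_presentation C_rank;
  C_gen : 'I_C_rank -> C_sort;
  C_presents : presents C_pres C_gen
}.

Definition C_generators (G : C_group) : set G := conjugates (@C_gen G).
Arguments C_generators : clear implicits.

Definition Hurwitz_presentation m (p : C_presentation m) : Prop :=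
  forall i : 'I_m, (1 <= C_h p i i)%N /\ C_w p i i 1%N = word_prod m.

(* The Hurwitz C-presentation may differ from the given C-presentation, but  *)
(* it has to define the same C-generators.                                   *)
Definition Hurwitz_C_group (G : C_group) : Prop :=
  exists (m : nat) (p : C_presentation m) (x : 'I_m -> G),
    [/\ (0 < m)%N, Hurwitz_presentation p, presents p x &
        conjugates x = C_generators G].

Definition irreducible_components (G : C_group) (n : nat) : Prop :=
  exists phi : {additive abelianization G -> 'rV[int]_n}, bijective phi.

Section Alexander.
Variable G : C_group.

(* The infinite cyclic group F_1 is written additively, as int with the      *)
(* fixed generator 1.                                                        *)
Lemma nu_exists : exists nu : G -> int,
  {morph nu : a b / (a * b)%g >-> a + b} /\
  (forall g, C_generators G g -> nu g = 1).
Proof.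
have [surj ker] := C_presents G; set x := @C_gen G in surj ker *.
set p := C_pres G in ker.
pose e (u : word (C_rank G)) : int := \sum_(l <- u) (-1) ^+ l.2.
have e_cat u v : e (u ++ v) = e u + e v by rewrite /e big_cat.
have e_inv u : e (word_inv u) = - e u.
  rewrite /e /word_inv big_rev big_map -sumrN.
  by apply: eq_bigr => -[i []] _ /=.
have e_eq u v : C_eq p u v -> e u = e v.
  elim=> // {u v} [u v w _ -> _ -> //|u u' v v' _ eu _ ev|i b|i j k _].
  - by rewrite !e_cat eu ev.
  - by rewrite /e !big_cons big_nil; case: b.
  - by rewrite !e_cat e_inv addrCA addNr addr0 /e !big_seq1.
have ev_cat u v : word_eval x (u ++ v) = (word_eval x u * word_eval x v)%g.
  by rewrite /word_eval big_cat.
have [r rK] := choice surj.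
have nuE u : e (r (word_eval x u)) = e u by apply/e_eq/ker/rK.
exists (e \o r); split=> [a b|_ [i [a ->]]] /=.
  by rewrite -e_cat -[RHS]nuE ev_cat !rK.
have -> : (x i ^ a)%g = word_eval x (word_inv (r a) ++ letter i ++ r a).
  have ev_inv u : word_eval x (word_inv u) = (word_eval x u)^-1%g.
    elim: u => [|[j b] u IH]; first by rewrite /word_eval big_nil invg1.
    rewrite /word_inv /= rev_cons -cats1 ev_cat -[rev _]/(word_inv u) IH.
    rewrite -[(j, b) :: u]cat1s ev_cat invgM; congr (_ * _)%g.
    by rewrite /word_eval !big_seq1 /=; case: b; rewrite ?invgK.
  by rewrite !ev_cat ev_inv rK /conjg /word_eval big_seq1.
by rewrite nuE !e_cat e_inv addrCA addNr addr0 /e big_seq1.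
Qed.

Definition nu : G -> int := sval (cid nu_exists).

Lemma nuM : {morph nu : a b / (a * b)%g >-> a + b}.
Proof. exact: (svalP (cid nu_exists)).1. Qed.

Lemma nu_generator g : C_generators G g -> nu g = 1.
Proof. exact: (svalP (cid nu_exists)).2. Qed.

Lemma nu1 : nu 1%g = 0.
Proof. by apply: (addrI (nu 1%g)); rewrite -nuM mulg1 addr0. Qed.

Lemma nuV a : nu a^-1%g = - nu a.
Proof. by apply/eqP; rewrite -addr_eq0 -nuM mulVg nu1. Qed.

Definition in_ker : pred G := fun g => nu g == 0.

Lemma in_ker_closed : group_closed in_ker.
Proof.
split=> [|a b]; rewrite /in_mem /= /in_ker ?nu1 //.
by rewrite nuM nuV => /eqP -> /eqP ->; rewrite subrr.
Qed.

Record nu_ker := InKer { ker_val : G; ker_valP : in_ker ker_val }.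
HB.instance Definition _ := [isSub for ker_val].
HB.instance Definition _ := [Choice of nu_ker by <:].
HB.instance Definition _ :=
  SubChoice_isSubGroup.Build G in_ker nu_ker in_ker_closed.

Lemma conj_in_ker (x : G) (b : nu_ker) : in_ker (val b ^ x)%g.
Proof.
rewrite /in_ker /conjg !nuM nuV addrCA addNr addr0; exact: (ker_valP b).
Qed.

Definition ker_conj (x : G) (b : nu_ker) : nu_ker :=
  Sub (val b ^ x)%g (conj_in_ker x b).

Lemma ker_conj_morphism x : monoid.monoid_morphism (ker_conj x).
Proof.
split=> [|a b]; apply: val_inj; rewrite [LHS]SubK.
  by rewrite val1 conj1g.
by rewrite !valM conjMg [val (ker_conj x a)]SubK [val (ker_conj x b)]SubK.
Qed.

HB.instance Definition _ x :=
  isUMagmaMorphism.Build nu_ker nu_ker (ker_conj x) (ker_conj_morphism x).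

(* For a C-generator x, this is the automorphism h : b |-> x^-1 b x of N/N'. *)
Definition h_ab (x : G) :
    {additive abelianization nu_ker -> abelianization nu_ker} :=
  ab_map (ker_conj x).

Variable R : realType.

Definition h_C (x : G) :
    {linear tensor (abelianization nu_ker) R[i] ->
            tensor (abelianization nu_ker) R[i]} :=
  tensor_map (h_ab x).

Definition Alexander_polynomial (x : G) : {poly R[i]} := det_sub_t (h_C x).

End Alexander.

(* Main.v *)
Require Import Defs.
From HB Require Import structures.
From mathcomp Require Import all_boot all_algebra.
From mathcomp Require Import boolp classical_sets reals complex.

Set Implicit Arguments.
Unset Strict Implicit.
Unset Printing Implicit Defensive.

Import GRing.Theory.

Local Open Scope ring_scope.

(** Write A = N/N' and h for the conjugation by x on A. Three facts about the
    Z[h]-module A decide the shape of its characteristic polynomial.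

    - h has finite order: the product of the m Hurwitz generators is central
      and differs from x^m by an element of N, and N acts trivially on A
      ([Hurwitz_periodic]).
    - A is finitely generated as an abelian group: the map sending g to the
      class of x^(-nu g) g is a crossed homomorphism G -> A, so its values are
      spanned by the h-translates of its values at the generators, and
      periodicity leaves finitely many translates ([Alexander_module_fg]).
    - A/(h - 1)A is free of rank n - 1: it is N/G', the kernel of the map
      Z^n = G/G' -> Z induced by nu ([coinvariants]).

    Since A/(h - 1)A is free, A splits as B + Z^(n-1) with B = (h - 1)A stable
    under h, and h acts on A modulo torsion by a block triangular integer
    matrix with blocks M (the action on B modulo torsion) and the identity.
    Hence det (h - t) is (1 - t)^(n-1) det (M - t). The value det (M - 1) is
    nonzero: if b = h c - c is fixed by h modulo torsion, then m b equals
    b + h b + ... + h^(m-1) b = h^m c - c = 0 modulo torsion, so b is torsion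
    ([lattice_matrix]). Finally, tensoring with a field of characteristic zero
    kills the torsion, so the matrix computed over Z is the matrix of h on
    (N/N') (x) C ([det_sub_t_tensor]). *)

(** * Finitely generated abelian groups modulo torsion *)

Section Lattice.
Variable A : zmodType.

Definition torsion (a : A) : Prop := exists2 k : int, k != 0 & a *~ k = 0.

Lemma torsion0 : torsion 0.
Proof. by exists 1; rewrite ?mul0rz. Qed.

Lemma torsionD a b : torsion a -> torsion b -> torsion (a + b).
Proof.
move=> [k k0 ak] [l l0 bl]; exists (k * l); first by rewrite mulf_neq0.
by rewrite mulrzDl mulrzA ak mulrC mulrzA bl !mul0rz addr0.
Qed.

Lemma torsionMz a k : torsion a -> torsion (a *~ k).
Proof. by move=> [l l0 al]; exists l; rewrite // mulrzAC al mul0rz. Qed.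

Lemma torsionN a : torsion a -> torsion (- a).
Proof. by rewrite -mulrN1z; apply: torsionMz. Qed.

Lemma torsionB a b : torsion a -> torsion b -> torsion (a - b).
Proof. by move=> ta tb; apply/torsionD/torsionN. Qed.

Lemma torsion_sum (I : Type) (s : seq I) (F : I -> A) :
  (forall i, torsion (F i)) -> torsion (\sum_(i <- s) F i).
Proof. by move=> tF; elim/big_ind: _ => //; [apply: torsion0|apply: torsionD]. Qed.

Lemma torsion_divMz a k : k != 0 -> torsion (a *~ k) -> torsion a.
Proof. by move=> k0 [l l0 al]; exists (k * l); rewrite ?mulf_neq0 // mulrzA. Qed.

Lemma torsion_raddf (h : {additive A -> A}) a : torsion a -> torsion (h a).
Proof. by move=> [k k0 ak]; exists k; rewrite // -raddfMz ak raddf0. Qed.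

(** Integer combinations stand in for the homomorphism from Z^r to A defined by
    a finite family; subgroups of A are handled through such families. *)
Definition comb r (t : 'I_r -> A) (v : 'rV[int]_r) : A := \sum_i t i *~ v 0 i.

Lemma comb_is_additive r (t : 'I_r -> A) : zmod_morphism (comb t).
Proof.
by move=> v w; rewrite /comb -sumrB; apply: eq_bigr => i _; rewrite !mxE mulrzBr.
Qed.

HB.instance Definition _ r (t : 'I_r -> A) :=
  GRing.isZmodMorphism.Build 'rV[int]_r A (comb t) (comb_is_additive t).

Lemma comb_mulmx r s (t : 'I_r -> A) (v : 'rV_s) (M : 'M_(s, r)) :
  comb t (v *m M) = comb (fun i => comb t (row i M)) v.
Proof.
rewrite /comb; under [RHS]eq_bigr do rewrite mulrz_suml.
rewrite exchange_big; apply: eq_bigr => j _.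
rewrite mxE mulrz_sumr; apply: eq_bigr => i _.
by rewrite mxE mulrC mulrzA.
Qed.

Lemma comb_delta r (t : 'I_r -> A) i : comb t (delta_mx 0 i) = t i.
Proof.
rewrite /comb (bigD1 i) //= mxE !eqxx big1 ?addr0 // => j ji.
by rewrite mxE (negPf ji) andbF.
Qed.

Lemma comb_split d k (b : 'I_(d + k) -> A) v w :
  comb b (row_mx v w) =
  comb (fun i => b (lshift k i)) v + comb (fun j => b (rshift d j)) w.
Proof.
rewrite /comb big_split_ord; congr (_ + _); apply: eq_bigr => i _.
  by rewrite row_mxEl.
by rewrite row_mxEr.
Qed.

(** A Bezout statement: every integer vector is a multiple of a vector that
    belongs to a basis of the lattice, by the Smith normal form of a single row. *)
Lemma unimodular_reduction n (v : 'rV[int]_n.+1) :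
  exists2 R : 'M[int]_n.+1, R \in unitmx & exists k, v = k *: row 0 R.
Proof.
have [L _ [R uR [d _ vE]]] := int_Smith_normal_form v.
exists R => //; exists (L 0 0 * d`_0).
rewrite vE {1}[L]mx11_scalar mul_scalar_mx -scalemxAl -scalerA; congr (_ *: _).
rewrite rowE scalemxAl; congr (_ *m _).
by apply/rowP=> j; rewrite !mxE eqxx /= eq_sym mulr_natr.
Qed.

Lemma comb_sub_torsion r (t : 'I_r -> A) (s : 'I_r -> A) v :
  (forall i, torsion (t i - s i)) -> torsion (comb t v - comb s v).
Proof.
move=> ts; rewrite /comb -sumrB; apply: torsion_sum => i.
by rewrite -mulrzBl; apply: torsionMz.
Qed.

(** A finitely generated abelian group is free modulo torsion. If a nonzero
    combination of the generators is torsion, then so is the one given by a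
    primitive vector; completing that vector to a basis of the lattice of
    coefficients makes one generator redundant, and the induction is on the
    number of generators. Subgroups are covered because the new family stays in
    the span of the given one. *)
Lemma free_mod_torsion r (t : 'I_r -> A) :
  exists d (u : 'I_d -> A),
  [/\ forall i, exists w, u i = comb t w,
      forall v, exists w, torsion (comb t v - comb u w)
    & forall w, torsion (comb u w) -> w = 0].
Proof.
elim: r t => [|r IHr] t.
  exists 0, t; split=> [i|v|w _]; first by exists (delta_mx 0 i); rewrite comb_delta.
    by exists v; rewrite subrr; apply: torsion0.
  by rewrite thinmx0.
have [tfree|/existsNP[v /not_implyP[tv /eqP v0]]] :=
  pselect (forall w, torsion (comb t w) -> w = 0).
  exists r.+1, t; split=> // [i|v]; first by exists (delta_mx 0 i); rewrite comb_delta.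
  by exists v; rewrite subrr; apply: torsion0.
have [R uR [k vE]] := unimodular_reduction v.
have k0 : k != 0 by apply: contraNneq v0; rewrite vE => ->; rewrite scale0r.
have tR0 : torsion (comb t (row 0 R)).
  by apply: (torsion_divMz k0); rewrite -raddfMz -scaler_int intz -vE.
pose R1 : 'M[int]_(1 + r) := R; pose t1 : 'I_(1 + r) -> A := t.
pose t' j := comb t1 (row (rshift 1 j) R1).
have [d [u [ut' t'u ufree]]] := IHr t'.
have t'E w : comb t' w = comb t1 (row_mx 0 w *m R1).
  by rewrite comb_mulmx comb_split raddf0 add0r.
exists d, u; split=> // [i|w].
  by have [w ->] := ut' i; rewrite t'E; eexists.
pose w1 : 'rV_(1 + r) := w *m invmx R.
have [w2 w2E] := t'u (rsubmx w1); exists w2.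
suff: torsion (comb t w - comb t' (rsubmx w1)).
  by move=> /torsionD/(_ w2E); rewrite addrA subrK.
rewrite -[w](mulmxKV uR) -[w *m _]/w1 -[w1 in comb _ (w1 *m _)]hsubmxK.
rewrite [comb t _](comb_mulmx t1 (row_mx _ _) R1) comb_split.
rewrite (_ : comb (fun i => _ (row (rshift 1 i) _)) _ = comb t' (rsubmx w1)) // addrK.
rewrite /comb big_ord1; apply: torsionMz.
have -> : lshift r (0 : 'I_1) = ord0 :> 'I_r.+1 by apply: val_inj.
exact: tR0.
Qed.

(** The arithmetic core. The family b consists of a basis of (h - 1)A modulo
    torsion, followed by a lift through q of the standard basis of Z^k; h
    fixes the lifts modulo (h - 1)A, whence the identity block. *)
Lemma lattice_matrix (h : {additive A -> A}) m r k (t : 'I_r -> A)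
    (q : {additive A -> 'rV[int]_k}) :
  (0 < m)%N -> (forall a, iter m h a = a) -> (forall a, exists v, a = comb t v) ->
  (forall w, exists a, q a = w) -> (forall a, q a = 0 <-> exists c, a = h c - c) ->
  exists d (b : 'I_(d + k) -> A) (M : 'M[int]_d) (N : 'M_(k, d)),
  [/\ forall a, exists v, torsion (a - comb b v),
      forall v, torsion (comb b v) -> v = 0,
      forall v, torsion (h (comb b v) - comb b (v *m block_mx M 0 N 1%:M))
    & \det (M - 1%:M) != 0].
Proof.
move=> m0 hm tA qsurj qker.
have [d [u [ut tu ufree]]] := free_mod_torsion (fun i => h (t i) - t i).
have t'E v : comb (fun i => h (t i) - t i) v = h (comb t v) - comb t v.
  rewrite /comb (raddf_sum h) -sumrB; apply: eq_bigr => i _.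
  by rewrite raddfMz mulrzBl.
have hu a : exists w, torsion (h a - a - comb u w).
  by have [v ->] := tA a; have [w] := tu v; exists w; rewrite -t'E.
have uh w : exists c, comb u w = h c - c.
  rewrite /comb; apply: (big_rec (fun a => exists c, a = h c - c)) => [|i a _ [c ->]].
    by exists 0; rewrite raddf0 subr0.
  have [v ->] := ut i; exists (comb t v *~ w 0 i + c).
  by rewrite t'E mulrzBl raddfD opprD addrACA raddfMz.
have qu w : q (comb u w) = 0 by apply/qker/uh.
have [s sE] := choice (fun j => qsurj (delta_mx 0 j)).
have qs w : q (comb s w) = w.
  rewrite /comb raddf_sum [RHS]row_sum_delta; apply: eq_bigr => j _.
  by rewrite raddfMz sE -scaler_int intz.
(* The target of q is torsion free. *)
have qtors a : torsion a -> q a = 0.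
  move=> [l l0 al]; apply/rowP=> j.
  have /rowP/(_ j)/eqP : q a *~ l = 0 by rewrite -raddfMz al raddf0.
  by rewrite -scaler_int intz !mxE mulf_eq0 (negPf l0) => /eqP.
pose b i := match split i with inl j => u j | inr j => s j end.
have bE v w : comb b (row_mx v w) = comb u v + comb s w.
  rewrite comb_split; congr (_ + _); apply: eq_bigr => i _; rewrite /b.
    by rewrite (unsplitK (inl i)).
  by rewrite (unsplitK (inr i)).
have /choice[Mr MrE] i : exists w, torsion (h (u i) - comb u w).
  have [c] := uh (delta_mx 0 i); rewrite comb_delta => ->; rewrite raddfB.
  exact: hu.
have [Nr NrE] := choice (fun j => hu (s j)).
pose M := \matrix_i Mr i; pose N := \matrix_j Nr j.
exists d, b, M, N; split.
- move=> a; have /qker[c cE] : q (a - comb s (q a)) = 0 by rewrite raddfB qs subrr.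
  have [w] := hu c; rewrite -cE => wE; exists (row_mx w (q a)).
  by rewrite bE opprD [- comb u w - _]addrC addrA.
- move=> v; rewrite -[v]hsubmxK bE => tv.
  have := qtors _ tv; rewrite raddfD /= qu qs add0r => r0.
  by move: tv; rewrite r0 raddf0 addr0 => /ufree ->; rewrite row_mx0.
- move=> v; rewrite comb_mulmx raddf_sum; under eq_bigr do rewrite raddfMz.
  apply: (@comb_sub_torsion _ (h \o b)) => i /=.
  rewrite /b; case: split_ordP => j ->.
    rewrite /block_mx rowKu row_row_mx raddf0 bE raddf0 addr0 rowK; exact: MrE.
  rewrite /block_mx rowKd row_row_mx bE rowK row1 comb_delta opprD.
  by rewrite [- comb u _ - _]addrC addrA; exact: NrE.
(* A kernel vector of M - 1 gives b = h c - c fixed by h modulo torsion; the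
   norm 1 + h + ... + h^(m-1) kills it and acts on it as m. *)
- apply/negP=> /det0P[v /eqP v0]; rewrite mulmxBr mulmx1 => /eqP.
  rewrite subr_eq0 => /eqP vM; apply: v0; apply: ufree.
  have hv : torsion (h (comb u v) - comb u v).
    rewrite -{2}vM comb_mulmx {1}/comb raddf_sum; under eq_bigr do rewrite raddfMz.
    by apply: (@comb_sub_torsion _ (h \o u)) => i /=; rewrite rowK.
  have [c cE] := uh v.
  have hmv j : torsion (iter j h (comb u v) - comb u v).
    elim: j => [|j IHj] /=; first by rewrite subrr; apply: torsion0.
    rewrite -(subrK (h (comb u v)) (h (iter _ _ _))) -addrA -raddfB.
    by apply: torsionD => //; apply: torsion_raddf.
  have sum0 : \sum_(j < m) iter j h (comb u v) = 0.
    have tele p : \sum_(j < p) iter j h (h c - c) = iter p h c - c.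
      elim: p => [|p IHp]; first by rewrite big_ord0 subrr.
      have iterB x y : iter p h (x - y) = iter p h x - iter p h y.
        by elim: (p) => //= j ->; rewrite raddfB.
      by rewrite big_ord_recr /= IHp iterB -iterSr addrC subrKA.
    by rewrite cE tele hm subrr.
  apply: (@torsion_divMz _ m).
    by rewrite -lt0n.
  have := torsion_sum (index_enum 'I_m) hmv.
  by rewrite sumrB sum0 sumr_const card_ord sub0r => /torsionN; rewrite opprK.
Qed.

End Lattice.

(** * Extension of scalars and the characteristic polynomial *)

Section TensorLift.
Variables (A : zmodType) (F : comNzRingType) (V : lmodType F).
Variable f : {additive A -> V}.

(** The universal property of the tensor product. *)
Definition tensor_lift (u : tensor A F) : V :=
  \sum_(ac <- repr u) ac.2 *: f ac.1.

Lemma tensor_lift_tsum s : tensor_lift (tsum s) = \sum_(ac <- s) ac.2 *: f ac.1.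
Proof.
have /tsumP : tsum (repr (tsum s)) = tsum s by rewrite tsum_repr.
rewrite /tensor_lift; move: (repr _) => r.
elim=> {r s} [//|s t _ -> //|s t r _ -> _ -> //|s s' t t' _ E1 _ E2|s t|a b d|a d e|a].
- by rewrite !big_cat E1 E2.
- by rewrite !big_cat /= addrC.
- by rewrite !big_cons !big_nil /= raddfD scalerDr !addr0.
- by rewrite !big_cons !big_nil /= scalerDl !addr0.
- by rewrite big_cons !big_nil scale0r addr0.
Qed.

Lemma tensor_liftE a c : tensor_lift (tens a c) = c *: f a.
Proof. by rewrite tensor_lift_tsum big_seq1. Qed.

Lemma tensor_lift_is_linear : linear tensor_lift.
Proof.
move=> c u v; rewrite -(tsum_repr u) -(tsum_repr v).
rewrite [_ *: _]tensor_scaleE [_ + _]tensor_addE !tensor_lift_tsum.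
rewrite big_cat big_map scaler_sumr; congr (_ + _).
by apply: eq_bigr => ac _; rewrite scalerA.
Qed.

HB.instance Definition _ :=
  GRing.isLinear.Build F (tensor A F) V _ tensor_lift tensor_lift_is_linear.

End TensorLift.

Section TensorBy.
Variables (A : zmodType) (F : comNzRingType).

Definition tens_by (c : F) (a : A) : tensor A F := tens a c.

Lemma tens_by_is_additive c : zmod_morphism (tens_by c).
Proof.
by move=> a b; apply/eqP; rewrite eq_sym subr_eq /tens_by -tensDl subrK.
Qed.

HB.instance Definition _ c := GRing.isZmodMorphism.Build A (tensor A F)
  (tens_by c) (tens_by_is_additive c).

Lemma tensMzl (a : A) k (c : F) : tens (a *~ k) c = k%:~R *: tens a c.
Proof. by rewrite scaler_int [LHS](raddfMz (tens_by c)). Qed.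

Lemma tensor_rect (P : tensor A F -> Prop) :
  P 0 -> (forall u v, P u -> P v -> P (u + v)) ->
  (forall c a, P (c *: tens a 1)) -> forall u, P u.
Proof.
move=> P0 PD Pt u; rewrite -(tsum_repr u) tsumE; elim/big_ind: _ => // -[a c] _ /=.
by rewrite -(mulr1 c) -tensZ.
Qed.

End TensorBy.

Lemma linear_matrix (F : fieldType) d e (g : 'rV[F]_d -> 'rV[F]_e) :
  linear g -> exists P, forall v, g v = v *m P.
Proof.
move=> glin; pose gl : {linear 'rV[F]_d -> 'rV[F]_e} :=
  HB.pack g (GRing.isLinear.Build _ _ _ _ g glin).
by exists (lin1_mx gl) => v; rewrite mul_rV_lin1.
Qed.

(** Any coordinates compute the determinant: two coordinate systems differ by
    an invertible matrix, which conjugates one matrix of f into the other. *)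
Lemma det_sub_t_eq (F : fieldType) (V : lmodType F) (f : {linear V -> V}) d
    (phi : {linear V -> 'rV[F]_d}) (M : 'M[F]_d) :
  bijective phi -> (forall v, phi (f v) = phi v *m M) ->
  det_sub_t f = \det (map_mx polyC M - 'X%:M).
Proof.
move=> bphi phif; apply: xget_unique; first by exists d, phi, M; split.
move=> _ [e [psi [N [bpsi psif ->]]]].
have [phi' phiK phi'K] := bphi; have [psi' psiK psi'K] := bpsi.
have lphi' : linear phi' by apply: can2_linear phiK phi'K.
have lpsi' : linear psi' by apply: can2_linear psiK psi'K.
have [P PE] : exists P, forall v, psi (phi' v) = v *m P.
  by apply: linear_matrix => c u v; rewrite lphi' linearP.
have [Q QE] : exists Q, forall v, phi (psi' v) = v *m Q.
  by apply: linear_matrix => c u v; rewrite lpsi' linearP.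
have PQ : P *m Q = 1%:M.
  by apply/row_matrixP=> i; rewrite !rowE mulmxA -PE -QE psiK phi'K mulmx1.
have QP : Q *m P = 1%:M.
  by apply/row_matrixP=> i; rewrite !rowE mulmxA -QE -PE phiK psi'K mulmx1.
have MP : M *m P = P *m N.
  apply/row_matrixP=> i; rewrite !rowE !mulmxA.
  by rewrite -{1}[delta_mx 0 i]phi'K -phif -!PE phiK psif.
have de : d = e by apply/eqP; rewrite eqn_leq (mulmx1_min PQ) (mulmx1_min QP).
case: _ / de => {e} in psi N bpsi psif psi' psiK psi'K lpsi' P PE Q QE PQ QP MP *.
have detPQ : \det (map_mx polyC P) * \det (map_mx polyC Q) = 1.
  by rewrite -det_mulmx -map_mxM PQ map_mx1 det1.
have -> : map_mx polyC M - 'X%:M =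
    map_mx polyC P *m (map_mx polyC N - 'X%:M) *m map_mx polyC Q.
  rewrite mulmxBr mulmxBl -!map_mxM -MP -(mulmxA M) PQ mulmx1.
  by rewrite scalar_mxC -mulmxA -map_mxM PQ map_mx1 mulmx1.
by rewrite !det_mulmx mulrAC detPQ mul1r.
Qed.

(** If b is a basis of A modulo torsion, then the b i (x) 1 form a basis of
    A (x) F, because nonzero integers are invertible in F, so that torsion
    elements of A vanish in the tensor product. *)
Lemma det_sub_t_tensor (F : numFieldType) (A : zmodType) (h : {additive A -> A})
    e (b : 'I_e -> A) (M : 'M[int]_e) :
  (forall a, exists v, torsion (a - comb b v)) ->
  (forall v, torsion (comb b v) -> v = 0) ->
  (forall v, torsion (h (comb b v) - comb b (v *m M))) ->
  det_sub_t (tensor_map h : {linear tensor A F -> tensor A F}) =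
    map_poly intr (\det (map_mx polyC M - 'X%:M)).
Proof.
move=> /choice[f fE] bfree hM.
have f_uniq a v : torsion (a - comb b v) -> f a = v.
  move=> tv; apply/eqP; rewrite -subr_eq0; apply/eqP/bfree.
  by have := torsionB tv (fE a); rewrite opprB addrC addrA subrK raddfB.
have fB : zmod_morphism f.
  move=> a c; apply: f_uniq; rewrite raddfB opprD addrACA -opprD.
  exact: torsionB.
have fb i : f (b i) = delta_mx 0 i.
  by apply: f_uniq; rewrite comb_delta subrr; apply: torsion0.
have fh a : f (h a) = f a *m M.
  apply: f_uniq.
  have := torsionD (torsion_raddf h (fE a)) (hM (f a)).
  by rewrite raddfB addrA subrK.
have fc_add : zmod_morphism (fun a => map_mx intr (f a) : 'rV[F]_e).
  by move=> a c; rewrite fB map_mxB.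
pose fC : {additive A -> 'rV[F]_e} :=
  HB.pack (fun a => map_mx intr (f a) : 'rV[F]_e)
    (GRing.isZmodMorphism.Build _ _ _ fc_add).
have tens_tors (a : A) (c : F) : torsion a -> tens a c = 0.
  move=> [k k0 ak]; have kF : k%:~R != 0 :> F by rewrite intr_eq0.
  by rewrite -[LHS](scalerK kF) -tensMzl ak [tens 0 c](raddf0 (tens_by c)) scaler0.
rewrite -det_map_mx; set N := map_mx _ _.
have -> : N = map_mx polyC (map_mx intr M) - 'X%:M.
  by apply/matrixP=> i j; rewrite !mxE raddfB /= map_polyC raddfMn /= map_polyX.
apply: (@det_sub_t_eq _ _ _ _ (tensor_lift fC)).
  pose g (v : 'rV[F]_e) : tensor A F := \sum_i tens (b i) (v 0 i).
  have gD v w : g (v + w) = g v + g w.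
    by rewrite /g -big_split; apply: eq_bigr => i _; rewrite mxE tensDr.
  have gZ c v : g (c *: v) = c *: g v.
    by rewrite /g scaler_sumr; apply: eq_bigr => i _; rewrite mxE tensZ.
  have gf a : g (fC a) = tens a 1.
    transitivity (tens (comb b (f a)) (1 : F)); last first.
      apply/eqP; rewrite eq_sym -subr_eq0; apply/eqP.
      by rewrite -[LHS](raddfB (tens_by 1)); apply: tens_tors.
    rewrite [RHS](raddf_sum (tens_by 1)); apply: eq_bigr => i _ /=.
    by rewrite mxE /tens_by tensMzl tensZ mulr1.
  exists g => [u|v].
    elim/tensor_rect: u => [|u v IHu IHv|c a].
    - by rewrite raddf0 -(scale0r (0 : 'rV_e)) gZ scale0r.
    - by rewrite raddfD gD IHu IHv.
    by rewrite linearZ /= tensor_liftE scale1r gZ gf.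
  rewrite /g raddf_sum [RHS]row_sum_delta; apply: eq_bigr => i _.
  by rewrite /= tensor_liftE /= fb map_delta_mx.
elim/tensor_rect => [|u v IHu IHv|c a].
- by rewrite !raddf0 mul0mx.
- by rewrite !raddfD /= IHu IHv mulmxDl.
rewrite !linearZ /= tensor_mapE !tensor_liftE !scale1r /= fh.
by rewrite map_mxM scalemxAl.
Qed.

(** * Words and groups given by presentations *)

Section Words.
Variables (K : groupType) (m : nat) (y : 'I_m -> K).

Lemma word_eval_cat u v :
  word_eval y (u ++ v) = (word_eval y u * word_eval y v)%g.
Proof. exact: big_cat. Qed.

Lemma word_eval_inv u : word_eval y (word_inv u) = (word_eval y u)^-1%g.
Proof.
elim: u => [|[j b] u IH]; first by rewrite /word_eval big_nil invg1.
rewrite /word_inv /= rev_cons -cats1 word_eval_cat -[rev _]/(word_inv u) IH.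
rewrite -[(j, b) :: u]cat1s word_eval_cat invgM; congr (_ * _)%g.
by rewrite /word_eval !big_seq1 /=; case: b; rewrite ?invgK.
Qed.

(** The inverse letters are covered by the last premise, in a form that only
    speaks of multiplication by generators. *)
Lemma presents_ind (p : C_presentation m) (P : K -> Prop) :
  presents p y -> P 1%g -> (forall g i, P g -> P (g * y i)%g) ->
  (forall g i, P (g * y i)%g -> P g) -> forall g, P g.
Proof.
move=> [surj _] P1 PM PV g; have [u <-] := surj g.
elim/last_ind: u => [|u [i b] IH]; first by rewrite /word_eval big_nil.
rewrite -cats1 word_eval_cat {2}/word_eval big_seq1 /=; case: b; last exact: PM.
by apply: (PV _ i); rewrite mulgVK.
Qed.

Lemma Hurwitz_central (p : C_presentation m) :
  presents p y -> Hurwitz_presentation p ->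
  forall g, commute (word_eval y (word_prod m)) g.
Proof.
move=> py Hp g; set c := word_eval y _.
have cy i : commute c (y i).
  have [h1 wE] := Hp i; have /py.2 := @Ceq_rel m p i i 1%N h1.
  rewrite wE !word_eval_cat word_eval_inv -/c [word_eval y (letter i)]big_seq1 /=.
  by rewrite /commute => {1}->; rewrite mulVKg.
move: g; apply: (presents_ind py) => [|g i cg|g i cg]; first exact: commute1.
  exact: commuteM.
by rewrite -(mulgK (y i) g); apply/commuteM/commuteV.
Qed.

End Words.

(** * Conjugation on the Alexander module *)

Lemma abel_ind (K : groupType) (P : abelianization K -> Prop) :
  (forall b, P (ab b)) -> forall a, P a.
Proof. by move=> Pab a; rewrite -(ab_repr a). Qed.

Lemma ab0 (K : groupType) : ab (1%g : K) = 0.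
Proof. by []. Qed.

Lemma abV (K : groupType) (b : K) : ab b^-1%g = - ab b.
Proof. by apply/eqP; rewrite -addr_eq0 -abM mulVg. Qed.

Lemma abJ (K : groupType) (b c : K) : ab (b ^ c)%g = ab b.
Proof. by rewrite /conjg !abM abV addrCA addNr addr0. Qed.

Section AlexanderModule.
Variables (G : C_group) (x : G).
Hypothesis Cx : C_generators G x.

Local Notation N := (nu_ker G).
Local Notation A := (abelianization (nu_ker G)).
Local Notation h := (h_ab x).

Lemma h_abM g g' (a : A) : h_ab (g * g')%g a = h_ab g' (h_ab g a).
Proof.
elim/abel_ind: a => b; rewrite /h_ab /= !ab_mapE; congr ab; apply: val_inj.
by rewrite !SubK conjgM.
Qed.

Lemma h_ab1 (a : A) : h_ab 1%g a = a.
Proof.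
elim/abel_ind: a => b; rewrite /h_ab /= !ab_mapE; congr ab; apply: val_inj.
by rewrite !SubK conjg1.
Qed.

(** Inner automorphisms act trivially on the abelianization. *)
Lemma h_ab_ker (b : N) a : h_ab (val b) a = a.
Proof.
elim/abel_ind: a => c; rewrite /h_ab /= ab_mapE -[RHS](abJ c b).
by congr ab; apply: val_inj; rewrite SubK /conjg !valM gmulfV.
Qed.

Definition zpow (k : int) : G :=
  match k with Posz n => x ^+ n | Negz n => x ^- n.+1 end%g.

Lemma zpowS k : zpow (k + 1) = (zpow k * x)%g.
Proof.
case: k => [k|[|k]]; first by rewrite -PoszD addn1 /= expgSr.
  by rewrite /= expg1 mulVg.
have -> : Negz k.+1 + 1 = Negz k.
  by rewrite !NegzE [in LHS]intS opprD addrAC addNr add0r.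
by rewrite /= [in RHS]expgS invgM mulgVK.
Qed.

Lemma zpowD k l : zpow (k + l) = (zpow k * zpow l)%g.
Proof.
elim/int_rect: l => [|l IHl|l IHl]; first by rewrite addr0 mulg1.
  by rewrite intS [1 + _]addrC addrA zpowS IHl -mulgA -zpowS.
apply: (mulIg x); rewrite -zpowS -addrA -mulgA -zpowS intS opprD [- 1 - _]addrC.
by rewrite addrNK.
Qed.

Lemma nu_zpow k : nu (zpow k) = k.
Proof.
elim/int_rect: k => [|k IHk|k IHk]; first exact: nu1.
  by rewrite intS addrC zpowS nuM IHk nu_generator.
apply: (addIr 1); transitivity (nu (zpow (- k.+1%:Z) * x)%g).
  by rewrite nuM (nu_generator Cx).
by rewrite -zpowS intS opprD addrAC addNr add0r.
Qed.

Lemma residue_in_ker g : in_ker ((zpow (nu g))^-1 * g)%g.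
Proof. by rewrite /in_ker nuM nuV nu_zpow addNr. Qed.

Definition residue g : N := Sub _ (residue_in_ker g).

(** The action of G on A factors through nu, as N acts trivially. *)
Lemma h_ab_nu g a : h_ab g a = h_ab (zpow (nu g)) a.
Proof.
have {1}-> : g = (zpow (nu g) * val (residue g))%g by rewrite SubK mulVKg.
by rewrite h_abM h_ab_ker.
Qed.

Lemma h_ab_generator g a : C_generators G g -> h_ab g a = h a.
Proof. by move=> Cg; rewrite h_ab_nu [RHS]h_ab_nu !nu_generator. Qed.

(** The crossed homomorphism that extends the projection N -> N/N' to G; the
    rule for products computes it on words, as in Fox calculus. *)
Definition crossed (g : G) : A := ab (residue g).

Lemma crossedM g g' : crossed (g * g')%g = h_ab g' (crossed g) + crossed g'.
Proof.
rewrite h_ab_nu /h_ab /crossed /= ab_mapE -abM; congr ab; apply: val_inj.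
rewrite valM !SubK nuM zpowD invgM /conjg; move: (zpow _) (zpow _) => a b.
by rewrite !mulgA mulgK.
Qed.

Lemma crossed_ker (b : N) : crossed (val b) = ab b.
Proof.
congr ab; apply: val_inj; rewrite SubK; have /eqP-> := valP b.
by rewrite invg1 mul1g.
Qed.

Lemma C_generators_gen i : C_generators G (C_gen i).
Proof. by exists i, 1%g; rewrite conjg1. Qed.

Lemma h_abX m a : h_ab (x ^+ m)%g a = iter m h a.
Proof. by elim: m => [|m IH]; rewrite ?h_ab1 // expgSr h_abM IH. Qed.

Lemma h_ab_gen i a : h_ab (C_gen i) a = h a.
Proof. by apply: h_ab_generator; apply: C_generators_gen. Qed.

(** The product of the Hurwitz generators is central and has the same image
    under nu as x^m, so h^m acts as a central element does. *)
Lemma Hurwitz_periodic : Hurwitz_C_group G ->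
  exists2 m, (0 < m)%N & forall a, iter m h a = a.
Proof.
move=> [m [p [y [m0 Hp py yG]]]]; exists m => // a.
have Cy i : C_generators G (y i) by rewrite -yG; exists i, 1%g; rewrite conjg1.
pose c := word_eval y (word_prod m).
have nuc : nu c = m.
  have nus s : nu (word_eval y [seq (i, false) | i <- s]) = size s.
    elim: s => [|i s IHs]; first by rewrite /word_eval big_nil nu1.
    by rewrite /= -cat1s word_eval_cat nuM IHs /word_eval big_seq1 /= nu_generator.
  by rewrite nus size_enum_ord.
rewrite -h_abX -[(x ^+ m)%g]/(zpow m) -nuc -h_ab_nu.
elim/abel_ind: a => b; rewrite /h_ab /= ab_mapE; congr ab; apply: val_inj.
rewrite SubK; apply/conjg_fixP/commgP/commute_sym.
exact: (Hurwitz_central py Hp).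
Qed.

(** * Generators and coinvariants of the Alexander module *)

Definition coboundary (a : A) := exists c, a = h c - c.

Lemma coboundaryB a b : coboundary a -> coboundary b -> coboundary (a - b).
Proof.
move=> [c ->] [d ->]; exists (c - d).
by rewrite (raddfB h) [in RHS]opprD addrACA -opprD.
Qed.

Lemma coboundary0 : coboundary 0.
Proof. by exists 0; rewrite raddf0 subrr. Qed.

Lemma coboundaryN a : coboundary a -> coboundary (- a).
Proof. by rewrite -sub0r; apply/coboundaryB/coboundary0. Qed.

Lemma coboundaryD a b : coboundary a -> coboundary b -> coboundary (a + b).
Proof. by move=> ca /coboundaryN cb; rewrite -(opprK b); apply: coboundaryB. Qed.

Lemma coboundary_h_ab g a : coboundary (h_ab g a - a).
Proof.
move: g a; apply: (presents_ind (@C_presents G)) => [a|g i IH a|g i IH a].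
- by rewrite h_ab1 subrr; apply: coboundary0.
- rewrite h_abM h_ab_gen -(subrK (h_ab g a) (h _)) -addrA.
  by apply: coboundaryD => //; exists (h_ab g a).
have := IH a; rewrite h_abM h_ab_gen => /coboundaryB IHa.
have : coboundary (h (h_ab g a) - h_ab g a) by exists (h_ab g a).
by move/IHa; rewrite opprB addrC addrA subrK.
Qed.

Lemma crossed_mod_coboundary g g' : coboundary (crossed (g * g')%g - (crossed g + crossed g')).
Proof. by rewrite crossedM opprD addrACA subrr addr0; apply: coboundary_h_ab. Qed.

Lemma crossed1 : crossed 1%g = 0.
Proof. by have := crossed_ker (1%g : N); rewrite val1. Qed.

(** Modulo (h - 1)A the crossed homomorphism becomes a homomorphism from G to an
    abelian group, hence vanishes on G'. *)
Lemma crossed_commutator g : commutator_subgroup g -> coboundary (crossed g).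
Proof.
elim=> {g} [_ [a [b ->]]||a b _ IHa _ IHb|a _ IHa].
- have := crossed_mod_coboundary a b; rewrite commgC => cab.
  have cba := crossed_mod_coboundary b a.
  have := crossed_mod_coboundary (b * a) [~ a, b]%g => cc.
  have := coboundaryB (coboundaryB cab cba) cc.
  rewrite [crossed b + _]addrC opprB addrA subrK opprB addrC.
  by rewrite [_ + crossed [~ a, b]%g - _]addrC addrA addrK addKr.
- by rewrite crossed1; apply: coboundary0.
- have := coboundaryD (crossed_mod_coboundary a b) (coboundaryD IHa IHb).
  by rewrite subrK.
have := coboundaryN (coboundaryD (crossed_mod_coboundary a a^-1) IHa).
by rewrite mulgV crossed1 sub0r opprD opprK addrC addKr.
Qed.

(** The h-translates of the values at the generators span A: writing g letter by
    letter, the crossed homomorphism only involves h and its inverse h^(m-1). *)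
Lemma Alexander_module_fg m : (0 < m)%N -> (forall a, iter m h a = a) ->
  exists r (t : 'I_r -> A), forall a, exists v, a = comb t v.
Proof.
move=> m0 hm.
pose I := ('I_(C_rank G) * 'I_m)%type.
pose t (i : 'I_#|{: I}|) := let ik := enum_val i in iter ik.2 h (crossed (C_gen ik.1)).
have iter_mod k a : iter k h a = iter (k %% m) h a.
  rewrite {1}(divn_eq k m) addnC iterD; congr (iter _ _ _).
  by elim: (k %/ m)%N => // l IHl; rewrite mulSn iterD IHl hm.
have tE i k : exists w, iter k h (crossed (C_gen i)) = comb t w.
  exists (delta_mx 0 (enum_rank (i, Ordinal (ltn_pmod k m0)))).
  by rewrite comb_delta /t enum_rankK /= iter_mod.
have ht v : exists w, h (comb t v) = comb t w.
  have /choice[w wE] i : exists w, h (t i) = comb t w.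
    by have [w wE] := tE (enum_val i).1 (enum_val i).2.+1; exists w; rewrite -wE.
  exists (v *m \matrix_i w i); rewrite comb_mulmx raddf_sum.
  by apply: eq_bigr => i _; rewrite rowK -wE raddfMz.
have iht k v : exists w, iter k h (comb t v) = comb t w.
  elim: k => [|k [w wE]]; first by exists v.
  by have [w' w'E] := ht w; exists w'; rewrite /= wE.
exists #|{: I}|, t => a; rewrite -(ab_repr a) -crossed_ker.
move: (val _); apply: (presents_ind (@C_presents G)) => [|g i [v gE]|g i [v gE]].
- by exists 0; rewrite raddf0 crossed1.
- have [w wE] := ht v; have [w' /= w'E] := tE i 0%N.
  by exists (w + w'); rewrite crossedM h_ab_gen gE wE w'E raddfD.
have [w' /= w'E] := tE i 0%N; have [w wE] := iht m.-1 (v - w').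
exists w.
by rewrite -wE (raddfB (comb t)) /= -gE -w'E crossedM h_ab_gen addrK -iterSr prednK ?hm.
Qed.

Lemma commutator_nu (g : G) : commutator_subgroup g -> nu g = 0.
Proof.
elim=> {g} [_ [a [b ->]]||a b _ nua _ nub|a _ nua]; last 3 first.
- exact: nu1.
- by rewrite nuM nua nub addr0.
- by rewrite nuV nua oppr0.
by rewrite /commg /conjg !nuM !nuV [nu a + _]addrC addKr addNr.
Qed.

Definition nu_ab (u : abelianization G) : int := nu (repr u).

Lemma nu_abE g : nu_ab (ab g) = nu g.
Proof.
have /eqP/ab_eqP/commutator_nu : ab (repr (ab g)) = ab g by rewrite ab_repr.
by rewrite nuM nuV => /eqP; rewrite addrC subr_eq0 => /eqP.
Qed.

Lemma nu_ab_is_additive : zmod_morphism nu_ab.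
Proof.
move=> u v; elim/abel_ind: u => a; elim/abel_ind: v => b.
by rewrite -abV -abM !nu_abE nuM nuV.
Qed.

HB.instance Definition _ := GRing.isZmodMorphism.Build _ _ nu_ab nu_ab_is_additive.

(** In coordinates of G/G' = Z^n adapted to the linear form nu, this form is k
    times the first coordinate with k nonzero, so the remaining n - 1
    coordinates identify N/G' with Z^(n-1); and N/G' is A/(h - 1)A by
    [crossed_commutator]. *)
Lemma coinvariants n : irreducible_components G n ->
  exists q : {additive A -> 'rV[int]_(n - 1)},
    (forall w, exists a, q a = w) /\ (forall a, q a = 0 <-> coboundary a).
Proof.
move=> [phi [phi' phiK phi'K]].
pose c := \col_i nu_ab (phi' (delta_mx 0 i)).
have nuE g : nu g = (phi (ab g) *m c) 0 0.
  set v := phi _; rewrite -nu_abE mxE.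
  have -> : ab g = comb (fun i => phi' (delta_mx 0 i)) v.
    rewrite -(phiK (ab g)) -/v; apply: (canLR phiK).
    rewrite /comb raddf_sum [LHS]row_sum_delta; apply: eq_bigr => i _.
    by rewrite raddfMz phi'K -scaler_int intz.
  rewrite raddf_sum; apply: eq_bigr => i _.
  by rewrite raddfMz [c _ _]mxE mulrC -[in RHS](intz (v 0 i)) mulrzr.
(* nu x = 1 excludes n = 0. *)
case: n => [|n] in phi phi' phiK phi'K c nuE *.
  by have := nu_generator Cx; rewrite nuE thinmx0 mul0mx mxE.
have [R uR [k cE]] := unimodular_reduction c^T.
pose U : 'M[int]_(1 + n) := R^T.
have uU : U \in unitmx by rewrite unitmx_tr.
have nuE' g : nu g = k * (phi (ab g) *m U) 0 0.
  rewrite nuE -[c]trmxK cE linearZ /= -scalemxAr mxE; congr (_ * _).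
  by rewrite tr_row colE mulmxA -colE mxE.
have k0 : k != 0.
  by apply/eqP=> k0; have := nu_generator Cx; rewrite nuE' k0 mul0r.
pose val_ab : {additive A -> abelianization G} :=
  ab_map (val : UMagmaMorphism.type N G).
have val_abE b : val_ab (ab b) = ab (val b) by apply: ab_mapE.
pose psi u : 'rV_(1 + n) := phi u *m U.
have psi0 (b : N) : lsubmx (psi (ab (val b))) = 0.
  apply/rowP=> j; rewrite ord1 [RHS]mxE mxE.
  rewrite (_ : lshift n 0 = 0); last exact: val_inj.
  have /eqP := valP b; rewrite nuE' => /eqP; rewrite mulf_eq0 (negPf k0) /=.
  by move/eqP.
rewrite subn1 /=.
pose q a : 'rV_n := rsubmx (psi (val_ab a)).
have qB : zmod_morphism q.
  by move=> a b; rewrite /q /psi !raddfB mulmxBl raddfB.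
pose qa : {additive A -> 'rV_n} := HB.pack q (GRing.isZmodMorphism.Build _ _ q qB).
exists qa; split=> [w|a] /=.
  pose v : 'rV_(1 + n) := row_mx 0 w.
  pose g := repr (phi' (v *m invmx U)).
  have psig : psi (ab g) = v by rewrite /psi ab_repr phi'K mulmxKV.
  have kg : in_ker g.
    rewrite /in_ker nuE' -[_ *m _]/(psi (ab g)) psig.
    rewrite (_ : 0 = lshift n (0 : 'I_1)); last exact: val_inj.
    by rewrite row_mxEl mxE mulr0.
  by exists (ab (Sub g kg)); rewrite /q val_abE SubK psig row_mxKr.
split=> [|[c' ->]].
  elim/abel_ind: a => b; rewrite /q val_abE => q0.
  have : psi (ab (val b)) = 0 by rewrite -[LHS]hsubmxK psi0 q0 row_mx0.
  move=> /(congr1 (mulmx^~ (invmx U))); rewrite mulmxK // mul0mx => phi0.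
  have : ab (1%g : G) = ab (val b).
    by apply: (can_inj phiK); rewrite phi0 ab0 raddf0.
  by move/eqP/ab_eqP; rewrite invg1 mul1g => /crossed_commutator; rewrite crossed_ker.
rewrite qB; apply/eqP; rewrite subr_eq0; apply/eqP.
elim/abel_ind: c' => b; rewrite /q [h_ab x _]ab_mapE !val_abE; congr (rsubmx (psi _)).
by rewrite SubK abJ.
Qed.

End AlexanderModule.

(** * The Alexander polynomial *)

Lemma det_sub_X_lblock (F : comNzRingType) d k (M : 'M[F]_d) (B : 'M_(k, d)) :
  \det (map_mx polyC (block_mx M 0 B 1%:M) - 'X%:M) =
  ('X - 1) ^+ k * ((-1) ^+ k * \det (map_mx polyC M - 'X%:M)).
Proof.
rewrite map_block_mx scalar_mx_block opp_block_mx add_block_mx.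
rewrite map_mx0 map_mx1 oppr0 addr0 det_lblock -scalar_mx_is_additive det_scalar.
by rewrite -[1 - _]opprB (exprNn ('X - 1)) mulrC -mulrA mulrCA.
Qed.

Lemma horner_det_sub_X (F : comNzRingType) d (M : 'M[F]_d) c :
  (\det (map_mx polyC M - 'X%:M)).[c] = \det (M - c%:M).
Proof.
rewrite -horner_evalE -det_map_mx; congr (\det _); apply/matrixP=> i j.
by rewrite !mxE /= /horner_eval hornerD hornerN hornerC hornerMn hornerX.
Qed.

Theorem theorem5p9 (R : realType) (G : C_group) (n : nat) (x : G)
    (HG : Hurwitz_C_group G) (Gn : irreducible_components G n)
    (Cx : C_generators G x) :
  exists P : {poly int},
    Alexander_polynomial R x = ('X - 1) ^+ (n - 1) * map_poly intr P /\
    P.[1] != 0.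
Proof.
have [m m0 hm] := Hurwitz_periodic Cx HG.
have [r [t tA]] := Alexander_module_fg Cx m0 hm.
have [q [qsurj qker]] := coinvariants Cx Gn.
have [d [b [M [B [bspan bfree hM MB]]]]] := lattice_matrix m0 hm tA qsurj qker.
exists ((-1) ^+ (n - 1) * \det (map_mx polyC M - 'X%:M)); split.
  rewrite /Alexander_polynomial /h_C (det_sub_t_tensor _ bspan bfree hM).
  by rewrite det_sub_X_lblock rmorphM rmorphXn /= rmorphB /= map_polyX rmorph1.
rewrite hornerM horner_det_sub_X mulf_neq0 // horner_exp hornerN hornerC.
by rewrite signr_eq0.
Qed.
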